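(* Let $m\ge 8$ be an even integer. Then the quaternary cyclic code $\mathcal{C}_{(0,m)}$ has parameters $[4^m-1,\,2^{2m-1}+1,\,d]$ (length, dimension over $\mathbb{F}_4$, minimum Hamming distance), where $$d\ \ge\ \begin{cases}4^{\frac{m-4}{2}}+1 & \text{if } m\equiv 2 \pmod 4,\\[2pt] 4^{\frac{m-4}{2}}+1 & \text{if } m\equiv 4\pmod 8.\end{cases}$$
   Context: Let $m\ge 1$ be an integer and $n=4^m-1$. For an integer $0\le i\le 4^m-1$ with base-$4$ expansion $i=\sum_{j=0}^{m-1} i_j4^j$, $i_j\in\{0,1,2,3\}$, the $4$-weight is $w_4(i)=\sum_{j=0}^{m-1} i_j$ (sum in $\mathbb{Z}$). Put $T_{(0,m)}=\{1\le i\le n-1 : w_4(i)\equiv 0 \pmod 2\}$. Fix a generator $\alpha$ of $\mathbb{F}_{4^m}^*$. The code $\mathcal{C}_{(0,m)}$ is the cyclic code of length $n$ over $\mathbb{F}_4$ (ideal of $\mathbb{F}_4[x]/(x^n-1)$) with generator polynomial $g_{(0,m)}(x)=\prod_{j\in T_{(0,m)}}(x-\alpha^j)\in\mathbb{F}_4[x]$. No distance bound is asserted when $m\equiv 0\pmod 8$. *)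

(* Defs.v *)
From HB Require Import structures.
From mathcomp Require Import all_boot all_order all_algebra all_fingroup.
From mathcomp Require Import all_solvable all_field zify.

Set Implicit Arguments.
Unset Strict Implicit.
Unset Printing Implicit Defensive.

Import GRing.Theory.
Local Open Scope ring_scope.

Section LinearCodes.
Variables (F : finFieldType) (n : nat).
Implicit Types (u v : 'rV[F]_n) (C : {vspace 'rV[F]_n}).

Definition hamming_dist u v : nat := #|[set i | u 0 i != v 0 i]|.

Definition is_min_dist C (d : nat) : Prop :=
  (exists u v, [/\ u \in C, v \in C, u != v & hamming_dist u v = d]) /\
  (forall u v, u \in C -> v \in C -> u != v -> (d <= hamming_dist u v)%N).

(* The length n is carried by the type of C. *)
Definition has_parameters C (k d : nat) : Prop :=
  \dim C = k /\ is_min_dist C d.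

End LinearCodes.

Section CyclicCode.
Variables (F : finFieldType) (n : nat) (g : {poly F}).

(* The principal ideal of F[x]/(x^n - 1) generated by the class of g, where the
   class of c_0 + c_1 x + ... + c_(n-1) x^(n-1) is read as the word
   (c_0, ..., c_(n-1)); see cyclic_codeP.  For n = 0 the type
   {poly %/ 'X^n - 1} is not the intended quotient. *)
Definition ideal_word (q : {poly %/ ('X^n - 1 : {poly F})}) : 'rV[F]_n :=
  poly_rV (val (q * in_qpoly ('X^n - 1) g)).

Definition cyclic_code : {vspace 'rV[F]_n} := limg (linfun ideal_word).

Lemma ideal_word_linear : linear ideal_word.
Proof.
move=> a p q; rewrite /ideal_word mulrDl -scalerAl.
have -> : forall x y : {poly %/ ('X^n - 1 : {poly F})},
    val (a *: x + y) = a *: val x + val y by [].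
exact: linearP.
Qed.

Lemma cyclic_codeP (c : 'rV[F]_n) : (0 < n)%N ->
  (c \in cyclic_code) <->
  (exists q : {poly %/ ('X^n - 1 : {poly F})},
     rVpoly c = val (q * in_qpoly ('X^n - 1) g)).
Proof.
move=> n_gt0.
pose lM := GRing.isLinear.Build _ _ _ _ ideal_word ideal_word_linear.
pose fL : {linear _ -> _} := HB.pack ideal_word lM.
have lE q : linfun ideal_word q = ideal_word q by exact: (lfunE fL q).
have sz (q : {poly %/ ('X^n - 1 : {poly F})}) : (size (val q) <= n)%N.
  have E : size (mk_monic ('X^n - 1 : {poly F})) = n.+1.
    by rewrite /mk_monic -polyC1 size_XnsubC // monicXnsubC // ltnS n_gt0
      size_XnsubC.
  by rewrite -ltnS -E size_mk_monic.
split=> [/memv_imgP[q _ ->]|[q qE]].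
  by exists q; rewrite lE /ideal_word poly_rV_K.
apply/memv_imgP; exists q; first exact: memvf.
by rewrite lE /ideal_word -qE rVpolyK.
Qed.

End CyclicCode.

Definition w4 (m i : nat) : nat := (\sum_(k < m) (i %/ 4 ^ k) %% 4)%N.

Section QuaternaryCode.
Variables (F L : finFieldType) (iota : {rmorphism F -> L}).
Variables (m : nat) (alpha : {unit L}).

Definition T0 : {set 'I_(4 ^ m - 1)} :=
  [set j : 'I_(4 ^ m - 1) | (0 < j)%N && (w4 m j == 0 %[mod 2])%N].

Definition g0L : {poly L} := \prod_(j in T0) ('X - (val alpha ^+ j)%:P).

(* g0L with its coefficients pulled back along iota; the default value 0 is
   never used (g0P). *)
Definition g0 : {poly F} :=
  map_poly (fun x : L => odflt 0 [pick a : F | iota a == x]) g0L.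

Definition C0 : {vspace 'rV[F]_(4 ^ m - 1)} := cyclic_code (4 ^ m - 1) g0.

End QuaternaryCode.

Lemma w4_mul4 m q r : (q < 4)%N -> w4 m.+1 (4 * r + q) = (q + w4 m r)%N.
Proof.
move=> q4; rewrite /w4 big_ord_recl expn0 divn1 mulnC modnMDl modn_small //.
congr addn; apply: eq_bigr => k _.
by rewrite lift0 expnS divnMA divnMDl // (divn_small q4) addn0.
Qed.

Lemma w4_top m q r : (q < 4)%N -> (r < 4 ^ m)%N ->
  w4 m.+1 (q * 4 ^ m + r) = (w4 m r + q)%N.
Proof.
move=> q4 rm; rewrite /w4 big_ord_recr /= divnMDl ?expn_gt0 //.
rewrite (divn_small rm) addn0 modn_small //; congr addn.
apply: eq_bigr => k _.
have -> : (4 ^ m = 4 ^ (m - k.+1) * 4 * 4 ^ k)%N.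
  by rewrite -mulnA -expnS -expnD subnK.
by rewrite mulnA divnMDl ?expn_gt0 // mulnA modnMDl.
Qed.

Lemma w4_shift m j : (0 < m)%N -> (j < 4 ^ m - 1)%N ->
  w4 m (4 * j %% (4 ^ m - 1)) = w4 m j.
Proof.
case: m => // m _ jn.
have p0 : (0 < 4 ^ m)%N by rewrite expn_gt0.
pose q := (j %/ 4 ^ m)%N; pose r := (j %% 4 ^ m)%N.
have jE : j = (q * 4 ^ m + r)%N by exact: divn_eq.
have r_lt : (r < 4 ^ m)%N by exact: ltn_pmod.
have q_lt : (q < 4)%N.
  by rewrite ltn_divLR // -expnS (leq_trans jn) ?leq_subr.
have E4 : (4 ^ m.+1 = 4 * 4 ^ m)%N by rewrite expnS.
have jm : (4 * j = q * (4 ^ m.+1 - 1) + (4 * r + q))%N by nia.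
rewrite jm modnMDl modn_small; last by nia.
by rewrite w4_mul4 // [in RHS]jE w4_top // addnC.
Qed.

Lemma generator_prim (L : finFieldType) (alpha : {unit L}) n :
  #|L| = n.+1 -> (0 < n)%N -> generator [set: {unit L}] alpha ->
  n.-primitive_root (val alpha).
Proof.
move=> cL n0 /eqP gen.
have oa : #[alpha]%g = n by rewrite orderE -gen card_finField_unit cL.
have uX k : val (alpha ^+ k)%g = val alpha ^+ k :> L.
  by elim: k => [|k IH]; rewrite ?expr0 // expgS exprS -IH.
have a1 : val alpha ^+ n = 1 by rewrite -uX -oa expg_order.
have [k pk kn] := prim_order_exists n0 a1.
suff -> : n = k by [].
apply/eqP; rewrite eqn_dvd kn andbT -oa order_dvdn; apply/eqP/val_inj.
by rewrite /= uX (prim_expr_order pk).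
Qed.

Lemma g0P (F L : finFieldType) (iota : {rmorphism F -> L}) (m : nat)
    (alpha : {unit L}) :
  #|F| = 4 -> #|L| = (4 ^ m)%N -> (0 < m)%N -> generator [set: {unit L}] alpha ->
  map_poly iota (g0 iota m alpha) = g0L m alpha.
Proof.
move=> cF cL m0 gen.
have N0 : (0 < 4 ^ m - 1)%N by rewrite subn_gt0 -{1}(expn0 4) ltn_exp2l.
have prim : (4 ^ m - 1).-primitive_root (val alpha).
  by apply: generator_prim => //; rewrite cL -[RHS]addn1 subnK ?expn_gt0.
have ch2F : 2%N \in [pchar F] by apply: (@card_finPcharP F 2 2).
have ch2 : 2%N \in [pchar L] by rewrite (fmorph_pchar iota).
have [f fE] : {f : {rmorphism L -> L} | forall x, f x = x ^+ 4}.
  exists (pFrobenius_aut ch2 \o pFrobenius_aut ch2) => x.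
  by rewrite /= !pFrobenius_autE -exprM.
have fixed : map_poly f (g0L m alpha) = g0L m alpha.
  rewrite rmorph_prod /=.
  pose s (j : 'I_(4 ^ m - 1)) : 'I_(4 ^ m - 1) := Ordinal (ltn_pmod (4 * j) N0).
  have co : coprime (4 ^ m - 1) 4.
    rewrite coprime_sym -(@coprime_pexpl m) // subn1 -{1}(@prednK (4 ^ m)) ?expn_gt0 //.
    exact: coprimeSn.
  have s_inj : injective s.
    move=> i j [/eqP E]; apply/val_inj/eqP => /=.
    wlog le_ij : i j E / (i <= j)%N.
      move=> W; case: (leqP i j) => [|/ltnW] le; first exact: W.
      by rewrite eq_sym; apply: W => //; rewrite eq_sym E.
    move: E; rewrite eq_sym eqn_mod_dvd ?leq_mul2l // -mulnBr Gauss_dvdr //.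
    by rewrite -eqn_mod_dvd // !modn_small // eq_sym.
  rewrite /g0L [RHS](reindex_inj s_inj) /=.
  apply: eq_big => j.
    rewrite !inE /= w4_shift //; congr (_ && _).
    rewrite !lt0n; congr (~~ _); apply/idP/idP => [/eqP->|].
      by rewrite muln0 mod0n.
    rewrite -/(dvdn _ _) Gauss_dvdr // => d; apply/eqP.
    by move: d; rewrite /dvdn modn_small // => /eqP.
  by move=> _; rewrite rmorphB /= map_polyX map_polyC /= fE -exprM mulnC
    (prim_expr_mod prim).
have im x : x ^+ 4 = x -> exists a : F, iota a = x.
  move=> x4; have /(congr1 (map_poly iota)) := finField_genPoly F.
  rewrite rmorphB /= map_polyXn map_polyX rmorph_prod /= cF => E.
  have : (('X^4 - 'X : {poly L}).[x] == 0) by rewrite !hornerE x4 subrr.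
  rewrite E horner_prod => /prodf_eq0 [a _].
  rewrite rmorphB /= map_polyX map_polyC !hornerE subr_eq0 => /eqP ->.
  by exists a.
apply/polyP => i; rewrite coef_map /g0 /= coef_map_id0 /=; last first.
  case: pickP => //= a /eqP E; apply: (fmorph_inj iota).
  by rewrite E rmorph0.
case: pickP => [a /eqP //|none].
have [|a aE] := im (g0L m alpha)`_i; first by rewrite -fE -coef_map fixed.
by have := none a; rewrite aE eqxx.
Qed.

(* Main.v *)
(** For i <= 4^k with 0 < k and 2k < m, the two blocks of base-4 digits of i(4^k + 1) do not
    overlap, so its 4-weight is twice that of i, hence even.  Thus the alpha^(i(4^k + 1)),
    0 < i <= 4^k, are zeros of the code; when the 2-adic valuation of k is at least that of
    m, alpha^(4^k + 1) is again a primitive root, and the BCH bound gives d > 4^k.  One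
    takes k = (m - 2)/2 for m = 2 mod 4 and k = (m - 4)/2 for m = 4 mod 8. *)

Require Import Defs.
From HB Require Import structures.
From mathcomp Require Import all_boot all_order all_algebra all_fingroup.
From mathcomp Require Import all_solvable all_field zify.

Set Implicit Arguments.
Unset Strict Implicit.
Unset Printing Implicit Defensive.

Import GRing.Theory.

(** * Base-4 weights and the number of zeros *)

Lemma w4_0 m : w4 m 0 = 0.
Proof. by rewrite /w4 big1 // => i _; rewrite div0n mod0n. Qed.

Lemma w4_1 m : w4 m.+1 1 = 1.
Proof. by rewrite (@w4_mul4 m 1 0) // w4_0. Qed.

Lemma w4_max m : w4 m (4 ^ m - 1) = 3 * m.
Proof.
elim: m => [|m IH]; first by rewrite /w4 big_ord0.
have p : 0 < 4 ^ m by rewrite expn_gt0.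
have -> : 4 ^ m.+1 - 1 = 3 * 4 ^ m + (4 ^ m - 1) by rewrite expnS; lia.
by rewrite w4_top ?IH //; lia.
Qed.

Lemma w4_cat k l a b : b < 4 ^ k -> w4 (k + l) (a * 4 ^ k + b) = w4 l a + w4 k b.
Proof.
elim: k b => [|k IH] b.
  by rewrite expn0 ltnS leqn0 => /eqP ->; rewrite w4_0 muln1 !addn0.
rewrite expnS => bk; have q4 : b %% 4 < 4 by rewrite ltn_pmod.
have -> : a * (4 * 4 ^ k) + b = 4 * (a * 4 ^ k + b %/ 4) + b %% 4.
  by have := divn_eq b 4; nia.
rewrite addSn w4_mul4 // IH; last by lia.
rewrite [in RHS](divn_eq b 4) (mulnC _ 4) w4_mul4 //; lia.
Qed.

Lemma odd_w4_mulS m k i : 0 < k -> k.*2 < m -> i <= 4 ^ k ->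
  odd (w4 m (i * (4 ^ k + 1))) = false.
Proof.
move=> k0 km; have p : 1 < 4 ^ k by rewrite -{1}(expn0 4) ltn_exp2l.
rewrite leq_eqVlt => /predU1P[->|ik].
  (* In the boundary case the only nonzero digits are two 1s, at positions [k] and [2k]; [2k < m]
     leaves room for the second. *)
  have -> : 4 ^ k * (4 ^ k + 1) = (1 * 4 ^ k + 1) * 4 ^ k + 0 by lia.
  have -> : m = k + (k + (m - k.*2).-1.+1) by lia.
  by rewrite w4_cat ?w4_cat ?w4_0; [case: (k) k0 => // k' _; rewrite !w4_1 | lia..].
have -> : i * (4 ^ k + 1) = i * 4 ^ k + (0 * 4 ^ k + i) by lia.
have -> : m = k + (k + (m - k.*2)) by lia.
rewrite w4_cat; last by lia.
by rewrite -[X in w4 (k + (m - _)) X](add0n i) -[X in X + i](mul0n (4 ^ k))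
  w4_cat // w4_0 mul0n add0n oddD addbb.
Qed.

(** The integers [4N, ..., 4N + 3] share all digits but the lowest, so exactly two of them have even
    weight. *)
Lemma sum_even_w4 m : 0 < m ->
  \sum_(0 <= j < 4 ^ m) ~~ odd (w4 m j) = 2 ^ (2 * m - 1).
Proof.
case: m => // m _.
have -> : 2 ^ (2 * m.+1 - 1) = 2 * 4 ^ m.
  by rewrite (_ : 2 * m.+1 - 1 = (2 * m).+1) ?expnS 1?(expnM 2 2) //; lia.
rewrite expnS; elim: (4 ^ m) => [|N IH]; first by rewrite !muln0 big_geq.
rewrite (_ : 4 * N.+1 = (4 * N).+4); last by lia.
rewrite !big_nat_recr //= IH.
have E q : q < 4 -> odd (w4 m.+1 (4 * N + q)) = odd q (+) odd (w4 m N).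
  by move=> q4; rewrite w4_mul4 ?oddD.
have := (E 0 isT, E 1 isT, E 2 isT, E 3 isT); rewrite addn0 addn1 addn2 addn3.
by move=> [] [] [] -> -> -> ->; case: (odd (w4 m N)) => /=; lia.
Qed.

(** The 2 accounts for the excluded exponents 0 and [4 ^ m - 1], whose weights 0 and [3 * m] are
    even because [m] is. *)
Lemma card_T0 m : 0 < m -> ~~ odd m -> #|T0 m| + 2 = 2 ^ (2 * m - 1).
Proof.
move=> m0 me; rewrite -sum_even_w4 //.
have p : 3 < 4 ^ m by rewrite -[X in X <= _](expn1 4) leq_exp2l.
have -> : #|T0 m| = \sum_(0 <= j < 4 ^ m - 1) (0 < j) && ~~ odd (w4 m j).
  rewrite -sum1dep_card big_mkcond /= big_mkord; apply: eq_bigr => j _.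
  by rewrite mod0n modn2 eqb0; case: (_ && _).
rewrite -{2}(@subnK 1 (4 ^ m)) 1?(leq_trans _ p) // addn1 big_nat_recr //= w4_max.
rewrite oddM (negPf me) andbF /= !(big_ltn (m := 0)) ?subn_gt0 ?(leq_trans _ p) //.
rewrite w4_0 /= add0n addn2 addn1 add1n; congr _.+2.
by rewrite !big_nat; apply: eq_bigr => j /andP[-> _].
Qed.

(** * Coprimality of [4 ^ k + 1] and [4 ^ m - 1] *)

Lemma dvdn_expS x b : odd b -> x + 1 %| x ^ b + 1.
Proof.
rewrite -[b in odd b]odd_double_half => ob; rewrite -[b]odd_double_half.
have -> : odd b by move: ob; rewrite oddD odd_double addbF oddb.
elim: b./2 => [|c IH]; first by rewrite expn1.
have -> : x ^ (true + c.+1.*2) = x * x * x ^ (true + c.*2).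
  by rewrite doubleS !addnS !expnS mulnA.
have := dvdn_mull (x * x) IH.
(* Subtraction-free form of [x^(b+2) + 1 = x^2 (x^b + 1) - (x - 1)(x + 1)]. *)
have E : x * x * (x ^ (true + c.*2) + 1) + (x + 1) = x * x * x ^ (true + c.*2) + 1 + x * (x + 1).
  by lia.
move=> d; rewrite -(dvdn_addl _ (dvdn_mull x (dvdnn (x + 1)))) -E dvdn_addl //.
Qed.

(* [x ^ (k * b)] is [-1] modulo a common divisor because [b] is odd, and it is [1] because
   [m] divides [k * b]. *)
Lemma coprime_expS_predX x k m a b : ~~ odd x -> 0 < x -> odd b -> k * b = m * a ->
  0 < m -> coprime (x ^ k + 1) (x ^ m - 1).
Proof.
move=> ox x0 ob kb m0.
set g := gcdn (x ^ k + 1) (x ^ m - 1).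
have gp : g %| (x ^ k) ^ b + 1 by apply: dvdn_trans (dvdn_expS _ ob); exact: dvdn_gcdl.
have gm : g %| (x ^ m) ^ a - 1.
  by rewrite subn1; apply: dvdn_trans (dvdn_pred_predX _ _); rewrite -subn1; exact: dvdn_gcdr.
have g2 : g %| 2.
  have pos : 0 < (x ^ m) ^ a by rewrite !expn_gt0 x0.
  have := dvdn_sub gp gm; rewrite -!expnM kb in pos *.
  by rewrite (_ : _ - _ = 2) //; lia.
have og : odd g.
  apply: (dvdn_odd (dvdn_gcdr _ _)); rewrite oddB ?expn_gt0 ?x0 // oddX (negPf ox).
  by rewrite orbF /=; case: (m) m0.
by rewrite /coprime -/g; case: g g2 og {gp gm} => [|[|[|g]]] //; move/dvdn_leq => /(_ isT).
Qed.

Local Open Scope ring_scope.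

(** * Cyclic codes, the BCH bound and minimum distance *)

Section CyclicCodes.
Variables (F : finFieldType) (n : nat) (g : {poly F}).
Hypotheses (n_gt0 : (0 < n)%N) (g_dvd : g %| 'X^n - 1).

Lemma mk_monic_XnsubC : mk_monic ('X^n - 1) = 'X^n - 1 :> {poly F}.
Proof.
by rewrite /mk_monic -polyC1 size_XnsubC // monicXnsubC // ltnS n_gt0.
Qed.

(** Since [g] divides ['X^n - 1], reduction modulo ['X^n - 1] preserves divisibility by [g]. *)
Lemma mem_cyclic_code (c : 'rV[F]_n) : (c \in cyclic_code n g) = (g %| rVpoly c).
Proof.
have hM : 'X^n - 1 \is @monic F by rewrite -polyC1 monicXnsubC.
have inE (p : {poly F}) : val (in_qpoly ('X^n - 1) p) = p %% ('X^n - 1).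
  by rewrite /= mk_monic_XnsubC -Pdiv.IdomainMonic.modpE.
have valM (q : {poly %/ ('X^n - 1 : {poly F})}) (p : {poly F}) :
    val (q * in_qpoly ('X^n - 1) p) = (val q * p) %% ('X^n - 1).
  have -> : val (q * in_qpoly ('X^n - 1) p)
      = val (in_qpoly ('X^n - 1) (val q * val (in_qpoly ('X^n - 1) p))) by [].
  by rewrite !inE modp_mul.
apply/idP/idP => [/(cyclic_codeP _ _ n_gt0)[q ->]|/dvdpP[q cE]].
  by rewrite valM -dvdp_mod ?dvdp_mull.
apply/(cyclic_codeP _ _ n_gt0); exists (in_qpoly ('X^n - 1) q).
rewrite -in_qpolyM -cE inE modp_small //.
by rewrite -polyC1 size_XnsubC // ltnS size_poly.
Qed.

Lemma dim_cyclic_code : \dim (cyclic_code n g) = (n - (size g).-1)%N.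
Proof.
have h0 : 'X^n - 1 != 0 :> {poly F} by rewrite -polyC1 monic_neq0 ?monicXnsubC.
have g0 : g != 0 by apply: contraNneq h0 => g0; rewrite -dvd0p -g0.
have gsz : (size g <= n.+1)%N.
  by rewrite (leq_trans (dvdp_leq h0 g_dvd)) // -polyC1 size_XnsubC.
have g1 : (0 < size g)%N by rewrite size_poly_gt0.
set k := (n - _)%N.
(* The map defining the code may have a kernel. Multiplying messages of length [n - deg g] by [g] is
   injective with the same image, which gives the dimension. *)
pose enc (r : 'rV[F]_k) : 'rV[F]_n := poly_rV (rVpoly r * g).
have encK r : rVpoly (enc r) = rVpoly r * g.
  apply: poly_rV_K; apply: leq_trans (size_polyMleq _ _) _.
  have : (size (rVpoly r) <= k)%N by exact: size_poly.
  by move: (size (rVpoly r)) => sr; rewrite /k; lia.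
have encL : linear enc by move=> a r s; rewrite /enc linearP /= mulrDl -scalerAl linearP.
pose lM := GRing.isLinear.Build _ _ _ _ enc encL.
pose fL : {linear _ -> _} := HB.pack enc lM.
have lE r : linfun enc r = enc r by exact: (lfunE fL r).
have -> : cyclic_code n g = limg (linfun enc).
  apply/vspaceP => c; rewrite mem_cyclic_code; apply/dvdpP/memv_imgP => [[q cE]|].
    exists (poly_rV q); rewrite ?memvf // lE.
    apply: (can_inj rVpolyK); rewrite encK cE poly_rV_K //.
    have [->|q0] := eqVneq q 0; first by rewrite size_poly0.
    have : (size (rVpoly c) <= n)%N by exact: size_poly.
    rewrite cE size_mul // /k; move: (size q) (size g) gsz g1 => sq sg; clear; lia.
  by case=> r _ ->; exists (rVpoly r); rewrite lE encK.
rewrite limg_dim_eq; first by rewrite dimvf dim_matrix; exact: mul1n.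
apply/vspaceP => r; rewrite memv_cap memvf memv_ker lE memv0 /=.
apply/eqP/eqP => [r0|->]; last by rewrite /enc !linear0 mul0r linear0.
apply/(can_inj rVpolyK); apply: (mulIf g0).
by rewrite -encK r0 !linear0 mul0r.
Qed.

End CyclicCodes.

(* In place of a Vandermonde determinant: the zeros say that the sum of
   c_s beta^s p(beta^s) vanishes for all p of size at most N, and the p vanishing at
   all but one of the locators beta^s isolates a single coordinate. *)
Lemma bch_bound (F L : fieldType) (iota : {rmorphism F -> L}) n (beta : L) N
    (c : 'rV[F]_n) :
  n.-primitive_root beta ->
  (forall i, (0 < i <= N)%N -> root (map_poly iota (rVpoly c)) (beta ^+ i)) ->
  c != 0 -> (N < #|[set i | (c 0 i != 0)%R]|)%N.
Proof.
move=> prim zeros c0; rewrite ltnNge; apply/negP => wN.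
have [s0 cs0] : exists s, c 0 s != 0.
  apply/existsP; apply: contraNT c0; rewrite negb_exists => /forallP c0.
  by apply/eqP/rowP => i; rewrite mxE; apply/eqP; have := c0 i; rewrite negbK.
have beta0 : beta != 0.
  apply: contra_eqN (prim_expr_order prim) => /eqP ->.
  by rewrite expr0n gtn_eqF ?(prim_order_gt0 prim) // eq_sym oner_eq0.
have inj : injective (fun s : 'I_n => beta ^+ s).
  move=> s t /eqP; rewrite (eq_prim_root_expr prim) !modn_small // => /eqP.
  exact: val_inj.
have evalE x : (map_poly iota (rVpoly c)).[x] = \sum_(s < n) iota (c 0 s) * x ^+ s.
  rewrite (horner_coef_wide _ (n := n)) ?size_map_poly ?size_poly //.
  by apply: eq_bigr => s _; rewrite coef_map coef_rVpoly_ord.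
(* The extra factor [beta ^+ s] pairs the coefficient of index [i] in [p] with the zero
   [beta ^+ i.+1], as the zeros start at exponent 1. *)
have vanish (p : {poly L}) : (size p <= N)%N ->
    \sum_(s < n) iota (c 0 s) * (beta ^+ s * p.[beta ^+ s]) = 0.
  move=> sp; under eq_bigr => s _.
    rewrite (horner_coef_wide _ sp) 2!mulr_sumr.
    over.
  rewrite exchange_big big1 //= => i _.
  have : (0 < i.+1 <= N)%N by rewrite ltn_ord.
  move/zeros; rewrite /root evalE => /eqP; move/(congr1 ( *%R p`_i)).
  rewrite mulr0 mulr_sumr => E; rewrite -[RHS]E; apply: eq_bigr => s _.
  by rewrite -!exprM mulSn exprD (mulnC i) [RHS]mulrCA [X in _ = _ * X]mulrCA.
(* [p] has degree one less than the weight of [c], hence size at most [N]. *)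
pose S := [set i | c 0 i != 0].
pose p := \prod_(s in S :\ s0) ('X - (beta ^+ s)%:P).
have := vanish p; rewrite (bigD1 s0) //= big1 ?addr0.
  move=> /(_ _)/eqP; rewrite !mulf_eq0 fmorph_eq0 (negPf cs0) expf_eq0 (negPf beta0).
  rewrite andbF /= horner_prod => H.
  have /H : (size p <= N)%N.
    rewrite /p -big_enum size_prod_XsubC -cardE.
    by rewrite (leq_trans _ wN) // -/S (cardsD1 s0 S) inE cs0.
  case/prodf_eq0 => s; rewrite !inE hornerXsubC subr_eq0 => /andP[ss0 _] /eqP/inj E.
  by rewrite E eqxx in ss0.
move=> s ss0; have [->|cs] := eqVneq (c 0 s) 0; first by rewrite rmorph0 mul0r.
by rewrite horner_prod (bigD1 s) ?inE ?ss0 //= hornerXsubC subrr mul0r !mulr0.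
Qed.

Lemma hamming_distE (F : finFieldType) n (u v : 'rV[F]_n) :
  hamming_dist u v = #|[set i | (u - v) 0 i != 0]|.
Proof. by apply: eq_card => i; rewrite !inE !mxE subr_eq0. Qed.

(** The words [vpick C] and 0 differ, so some distance is attained, and hence a least one. *)
Lemma is_min_dist_ex (F : finFieldType) n (C : {vspace 'rV[F]_n}) :
  (0 < \dim C)%N -> exists d, is_min_dist C d.
Proof.
move=> dC.
pose P d := [exists u, exists v, [&& u \in C, v \in C, u != v & hamming_dist u v == d]].
have exP : exists d, P d.
  exists (hamming_dist (vpick C) 0); apply/existsP; exists (vpick C).
  by apply/existsP; exists 0; rewrite memv_pick mem0v vpick0 -dimv_eq0 -lt0n dC /=.
case: (ex_minnP exP) => d /existsP[u /existsP[v /and4P[uC vC uv /eqP dE]]] min.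
exists d; split; first by exists u, v.
by move=> x y xC yC xy; apply: min; apply/existsP; exists x; apply/existsP; exists y;
  rewrite xC yC xy /=.
Qed.

(** * Dimension and distance of [C0] *)

Section CodeC0.
Variables (F L : finFieldType) (iota : {rmorphism F -> L}) (m : nat).
Variable alpha : {unit L}.
Hypotheses (cardF : #|F| = 4) (cardL : #|L| = (4 ^ m)%N) (m_gt0 : (0 < m)%N).
Hypothesis alpha_gen : generator [set: {unit L}]%g alpha.

Let n_gt0 : (0 < 4 ^ m - 1)%N.
Proof. by rewrite subn_gt0 -{1}(expn0 4) ltn_exp2l. Qed.

Lemma alpha_prim : (4 ^ m - 1).-primitive_root (val alpha).
Proof. by apply: generator_prim => //; rewrite cardL -[RHS]addn1 subnK ?expn_gt0. Qed.

Lemma size_g0 : size (g0 iota m alpha) = #|T0 m|.+1.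
Proof.
rewrite -(size_map_poly iota) g0P // /g0L -big_enum size_prod_XsubC.
by rewrite -cardE.
Qed.

(** Over [L], ['X^n - 1] is the product of all ['X - alpha^j], and [g0] maps to the subproduct over
    [T0]. *)
Lemma g0_dvd_XnsubC : g0 iota m alpha %| 'X^(4 ^ m - 1) - 1.
Proof.
rewrite -(dvdp_map iota) g0P // rmorphB /= map_polyXn rmorph1.
rewrite -(factor_Xn_sub_1 alpha_prim) big_mkord (bigID (mem (T0 m))) /=.
exact: dvdp_mulIl.
Qed.

Lemma C0_root c j : c \in C0 iota m alpha -> (0 < j < 4 ^ m - 1)%N ->
  ~~ odd (w4 m j) -> root (map_poly iota (rVpoly c)) (val alpha ^+ j).
Proof.
rewrite mem_cyclic_code ?g0_dvd_XnsubC // -(dvdp_map iota) g0P //.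
move=> /dvdpP[q ->] /andP[j0 jn] ew; rewrite rootM /g0L; apply/orP; right.
rewrite (bigD1 (Ordinal jn)) ?rootM ?root_XsubC ?eqxx //=.
by rewrite inE j0 mod0n modn2 eqb0.
Qed.

Lemma dim_C0 : ~~ odd m -> \dim (C0 iota m alpha) = (2 ^ (2 * m - 1) + 1)%N.
Proof.
move=> me; rewrite dim_cyclic_code ?g0_dvd_XnsubC // size_g0 /=.
have p4 : (4 ^ m = 2 * 2 ^ (2 * m - 1))%N.
  by rewrite -expnS (_ : (2 * m - 1).+1 = 2 * m)%N ?(expnM 2 2) //; lia.
have := card_T0 m_gt0 me; move: #|T0 m| p4 => t.
by move: (4 ^ m)%N (2 ^ _)%N; lia.
Qed.

(** The witnesses [a] and [b], with [b] odd, encode that the 2-adic valuation of [k] is at least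
    that of [m]. *)
Lemma C0_min_dist k a b d : (0 < k)%N -> (k.*2 < m)%N -> odd b -> (k * b = m * a)%N ->
  is_min_dist (C0 iota m alpha) d -> (4 ^ k < d)%N.
Proof.
move=> k0 km ob kb [[u [v [uC vC uv <-]]] _]; rewrite hamming_distE.
have co : coprime (4 ^ k + 1) (4 ^ m - 1) by exact: (coprime_expS_predX _ _ ob kb).
have prim := alpha_prim; rewrite -(prim_root_exp_coprime _ prim) in co.
apply: (bch_bound (iota := iota) co); rewrite ?subr_eq0 // => i /andP[i0 ik].
rewrite -exprM mulnC; apply: C0_root; rewrite ?rpredB ?odd_w4_mulS //.
rewrite muln_gt0 i0 addn1 ltnS leq0n /=.
have p : (3 < 4 ^ k)%N by rewrite -[X in (X <= _)%N](expn1 4) leq_exp2l.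
(* From [2k + 1 <= m], the largest exponent [4^k (4^k + 1)] stays below [4 ^ m - 1]. *)
have : (4 * (4 ^ k * 4 ^ k) <= 4 ^ m)%N by rewrite -expnD -expnS leq_exp2l //; lia.
by nia.
Qed.

End CodeC0.

Local Close Scope ring_scope.

Theorem theorem5p2p2 (F L : finFieldType) (iota : {rmorphism F -> L})
    (m : nat) (alpha : {unit L}) :
  #|F| = 4 -> #|L| = 4 ^ m ->
  generator [set: {unit L}]%g alpha ->
  8 <= m -> ~~ odd m ->
  exists d : nat,
    has_parameters (C0 iota m alpha) (2 ^ (2 * m - 1) + 1) d /\
    (m = 2 %[mod 4] -> 4 ^ ((m - 4) %/ 2) + 1 <= d) /\
    (m = 4 %[mod 8] -> 4 ^ ((m - 4) %/ 2) + 1 <= d).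
Proof.
move=> cF cL gen m8 me; have m0 : 0 < m by exact: leq_trans m8.
have dimC := dim_C0 iota cF cL m0 gen me.
have [|d dP] := @is_min_dist_ex _ _ (C0 iota m alpha); first by rewrite dimC addn1.
exists d; split; first by split.
split=> mE; rewrite addn1.
(* Here [k = 2t] and [2t (2t + 1) = t m]; the resulting bound exceeds the stated one, whose exponent
   is [2t - 1]. *)
- have [t tE] : exists t, m = 4 * t + 2 by exists (m %/ 4); lia.
  have d_gt : 4 ^ t.*2 < d.
    by apply: (C0_min_dist cF cL m0 gen (a := t) (b := t.*2.+1) _ _ _ _ dP);
      rewrite ?tE /= ?odd_double //; lia.
  by apply: leq_ltn_trans d_gt; rewrite leq_exp2l //; lia.
(* Now [(m - 2) / 2 = 4t + 1] is odd and fails the valuation condition, so [k = 4t], with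
   [4t (2t + 1) = t m]. *)
- have [t tE] : exists t, m = 8 * t + 4 by exists (m %/ 8); lia.
  have -> : (m - 4) %/ 2 = 4 * t by lia.
  by apply: (C0_min_dist cF cL m0 gen (a := t) (b := t.*2.+1) _ _ _ _ dP);
    rewrite ?tE /= ?odd_double //; lia.
Qed.
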